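(* Let $G=(V,E,m,\mu)$ be an unweighted physical graph satisfying the $\mathrm{CD}(0,\infty)$ condition and $\inf_{x\in V}\mathrm{d}_x\geq 2$. If $\mathrm{Gir}(x_0)\geq 5$ for some $x_0\in V$, then the graph $(V,E)$ is (isomorphic to) either the infinite line $P_{\mathbb{Z}}$ or a cycle graph $C_n$ for some $n\geq 5$.
   Context: All graphs $(V,E)$ are undirected, connected, locally finite and simple (finite or infinite, with more than one vertex). Write $x\sim y$ if $\{x,y\}\in E$, and let $\mathrm{d}_x$ be the number of neighbors of $x$. An unweighted physical graph is a graph $(V,E)$ with edge weights $\mu_{xy}=1$ for all $\{x,y\}\in E$ and vertex weights $m_x=1$ for all $x\in V$. For $f,g:V\to\mathbb{R}$: $\Delta f(x)=\frac{1}{m_x}\sum_{y\sim x}\mu_{xy}(f(y)-f(x))=\sum_{y\sim x}(f(y)-f(x))$, $\Gamma(f,g)=\frac12(\Delta(fg)-f\Delta g-g\Delta f)$, $\Gamma(f)=\Gamma(f,f)$, $\Gamma_2(f)=\frac12\Delta\Gamma(f)-\Gamma(f,\Delta f)$. The graph satisfies $\mathrm{CD}(0,\infty)$ if $\Gamma_2(f)(x)\geq 0$ for all $f:V\to\mathbb{R}$ and all $x\in V$. A cycle of length $k>2$ is a walk $x_0\sim x_1\sim\cdots\sim x_k$ with $x_0=x_k$ and $x_0,\dots,x_{k-1}$ pairwise distinct. The girth $\mathrm{Gir}(x)$ of a vertex $x$ is the minimal length of cycles passing through $x$ ($\infty$ if there is none). $P_{\mathbb{Z}}$ is the graph on $\mathbb{Z}$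 with $i\sim i+1$ for all $i\in\mathbb{Z}$; $C_n$ is the cycle graph with $n$ vertices. *)

(* Defs.v *)
From mathcomp Require Import all_boot all_order all_algebra.
From mathcomp Require Import finmap all_classical reals ereal.

Set Implicit Arguments.
Unset Strict Implicit.
Unset Printing Implicit Defensive.

Import Order.TTheory GRing.Theory Num.Theory.

Local Open Scope classical_set_scope.
Local Open Scope ring_scope.

Record weighted_graph (R : realType) (V : choiceType) := WeightedGraph {
  adj : rel V;
  edge_weight : V -> V -> R; (* values on non-edges are irrelevant *)
  vertex_weight : V -> R;
  adj_sym : symmetric adj;
  adj_irrefl : irreflexive adj;
  adj_locally_finite : forall x, finite_set [set y | adj x y];
  adj_connected : forall x y, exists2 p, path adj x p & last x p = y;
  two_vertices : exists x y : V, x != y;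
  edge_weight_sym : forall x y, edge_weight x y = edge_weight y x;
  edge_weight_gt0 : forall x y, adj x y -> 0 < edge_weight x y;
  vertex_weight_gt0 : forall x, 0 < vertex_weight x }.

Section Definitions.
Variables (R : realType) (V : choiceType) (G : weighted_graph R V).
Implicit Types (f g : V -> R) (x y : V).

Definition unweighted_physical :=
  (forall x y, adj G x y -> edge_weight G x y = 1) /\
  (forall x, vertex_weight G x = 1).

Definition degree x : nat := #|` fset_set [set y | adj G x y] |.

Definition laplacian f x : R :=
  (vertex_weight G x)^-1 *
    \sum_(y \in [set y | adj G x y]) edge_weight G x y * (f y - f x).

Definition Gamma f g x : R :=
  2^-1 * (laplacian (f \* g) x - f x * laplacian g x - g x * laplacian f x).

Definition Gamma2 f x : R :=
  2^-1 * laplacian (Gamma f f) x - Gamma f (laplacian f) x.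

Definition CD0oo := forall f x, 0 <= Gamma2 f x.

(* A cycle x_0 ~ ... ~ x_k = x_0 is the sequence [:: x_0; ...; x_(k-1)]. *)
Definition cycles_through x : set (seq V) :=
  [set c | [/\ (2 < size c)%N, ucycle (adj G) c & x \in c]].

(* +oo when no cycle passes through x *)
Definition girth x : \bar R :=
  ereal_inf [set (size c)%:R%:E | c in cycles_through x].

End Definitions.

Definition graph_isomorphic (V W : Type) (e : rel V) (e' : rel W) :=
  exists2 h : V -> W, bijective h & forall x y, e' (h x) (h y) = e x y.

Definition line_adj : rel int := fun i j => (j == i + 1) || (i == j + 1).

(* ordS i is i + 1 modulo n; this is the cycle graph C_n for n >= 3. *)
Definition cycle_adj (n : nat) : rel 'I_n :=
  fun i j => (j == ordS i) || (i == ordS j).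

(* Main.v *)
Require Import Defs.
From mathcomp Require Import all_boot all_order all_algebra.
From mathcomp Require Import all_classical reals ereal.
From mathcomp Require Import finmap zify ring lra.

Set Implicit Arguments.
Unset Strict Implicit.
Unset Printing Implicit Defensive.

Import Order.TTheory GRing.Theory Num.Theory.

Local Open Scope classical_set_scope.
Local Open Scope ring_scope.

(** Write d(v) for the degree of v. The curvature condition at a vertex x with
no 3- or 4-cycle through it bounds the degrees near x. Indeed no two neighbours
of x are then adjacent, and a vertex at distance 2 from x is adjacent to only
one of them. So for two distinct neighbours y1, y2 of x there is a function f
with f(x) = 0, f(y1) = 1, f(y2) = -1, equal to 2 and -2 on the other neighbours
of y1 and of y2, and to 0 elsewhere in the 2-ball (it is linear along every path
of length 2 starting at x, which minimises Gamma2 at x among the functions with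
these values on the 1-ball). A direct computation gives
  4 Gamma2(f)(x) = 8 - d(y1) - d(y2) - 2 d(x),
so CD(0, oo) and minimal degree 2 force d(x) = d(y1) = d(y2) = 2
([curvature_degree]).

The absence of 3- and 4-cycles spreads: if y ~ x has degree 2, a short cycle
through y has to use both edges at y, hence passes through x
([no_short_cycle_neighbor]). By connectedness every vertex has degree 2.

A connected 2-regular graph is a line or a cycle ([two_regular_classification]):
walking without backtracking gives a map from the integers to V which follows
the edges and is onto; either it is injective, or it is periodic with its first
return time as period. Finally C_n contains an n-cycle through each of its
vertices, so n is at least the girth of x0 ([cycle_girth]). *)

(** * Connected 2-regular graphs *)

Section TwoRegular.
Variables (V : choiceType) (e : rel V).

Definition two_neighbors x := exists a b,
  a != b /\ forall y, e x y = (y == a) || (y == b).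

(** A walk without backtracking; listing all neighbours of w i makes the walk
determined by any two consecutive vertices. *)
Definition straight_walk (w : int -> V) := forall i,
  w (i - 1) != w (i + 1) /\
  forall y, e (w i) y = (y == w (i - 1)) || (y == w (i + 1)).

Lemma graph_isomorphic_of_bij (W : Type) (e' : rel W) (f : W -> V) :
  injective f -> (forall v, exists i, f i = v) ->
  (forall i j, e (f i) (f j) = e' i j) -> graph_isomorphic e e'.
Proof.
move=> f_inj /choice[g fgK] fe; exists g; last by move=> x y; rewrite -fe !fgK.
by exists f => // i; apply: f_inj; rewrite fgK.
Qed.

Hypothesis e_sym : symmetric e.
Hypothesis e_two : forall x, two_neighbors x.

(** Iterate in both directions the map that sends a directed edge (u, v) to
(v, z), where z is the neighbour of v other than u. By 2-regularity this map is
invertible on directed edges, so its iterates are indexed by the integers. *)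
Lemma straight_walk_exists (x : V) : exists w, straight_walk w.
Proof.
have /choice[other otherP] (d : V * V) : exists z, e d.1 d.2 ->
    d.1 != z /\ forall y, e d.2 y = (y == d.1) || (y == z).
  case: d => u v /=; have [a [b [ab eab]]] := e_two v.
  have [->|ua] := eqVneq u a; first by exists b.
  exists a => euv; split=> // y; rewrite eab.
  by move: euv; rewrite e_sym eab (negPf ua) => /eqP ->; rewrite orbC.
(* bwd reverses the edge, takes the next one, and reverses again. *)
pose fwd (d : V * V) := (d.2, other d).
pose bwd (d : V * V) := (other (d.2, d.1), d.1).
pose dart (d : V * V) := e d.1 d.2.
have fwd_dart d : dart d -> dart (fwd d).
  by move=> /otherP[_ eE]; rewrite /dart /= eE eqxx orbT.
have bwd_dart d : dart d -> dart (bwd d).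
  rewrite /dart [e d.1 _]e_sym => /(otherP (d.2, d.1))[_ /= eE].
  by rewrite e_sym eE eqxx orbT.
have bwdK d : dart d -> fwd (bwd d) = d.
  move=> dd; rewrite /fwd /=; move: (bwd_dart _ dd); set d' := bwd d => dd'.
  have [ne' eE'] := otherP _ dd'.
  have: e d.2 d.1 by rewrite e_sym.
  move=> /(otherP (d.2, d.1))[/= ne eE].
  have := eE d.2; rewrite eqxx /= (eE' d.2).
  by rewrite /d' /= (negPf ne) /= => /eqP <-; case: (d).
have [a [b [_ eab]]] := e_two x.
have d0 : dart (x, a) by rewrite /dart /= eab eqxx.
pose D (i : int) := match i with
  | Posz n => iter n fwd (x, a) | Negz n => iter n.+1 bwd (x, a) end.
have DD i : dart (D i).
  by case: i => n; [elim: n => //= n IH; exact: fwd_dart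
                   | elim: n => [|n IH]; apply: bwd_dart].
have DS i : D (i + 1) = fwd (D i).
  case: i => n; first by rewrite -PoszD addn1.
  case: n => [|n]; first by rewrite bwdK.
  have -> : Negz n.+1 + 1 = Negz n by lia.
  by rewrite [D (Negz n.+1)]/= -/(iter n.+1 bwd (x, a)) bwdK //; exact: (DD (Negz n)).
exists (fun i => (D i).1) => i; have := DS (i - 1); rewrite subrK => Di.
by rewrite DS Di; exact: otherP (DD _).
Qed.

Hypothesis e_irr : irreflexive e.
Hypothesis e_conn : forall x y, exists2 p, path e x p & last x p = y.

(** The image of the walk is closed under taking neighbours, hence is the whole
connected graph. *)
Lemma straight_walk_surj w v : straight_walk w -> exists i, w i = v.
Proof.
move=> wP; have [p] := e_conn (w 0) v.
elim: p 0 => [|y p IH] i /=; first by exists i.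
by case/andP; rewrite (wP i).2 => /orP[]/eqP-> /IH.
Qed.

(** If w (i + k) = w i with k minimal, then w (i + k - 1) is one of the two
neighbours of w i; it is not w (i + 1), which would give a return in time
k - 2. So it is w (i - 1): the walk crosses the same directed edge at times
i - 1 and i + k - 1. A directed edge determines the whole walk, so k is a
period. *)
Lemma straight_walk_period w (k : nat) : straight_walk w ->
  (0 < k)%N -> (exists i, w (i + k%:Z) = w i) ->
  (forall m, (0 < m < k)%N -> forall i, w (i + m%:Z) <> w i) ->
  (2 < k)%N /\ forall i, w (i + k%:Z) = w i.
Proof.
move=> wP k0 [i wi] kmin.
have nS j : w (j + 1) <> w j.
  by move=> wj; have := e_irr (w j); rewrite (wP j).2 -{2}wj eqxx orbT.
have nSS j : w (j + 2) <> w j.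
  move=> wj; have [/eqP + _] := wP (j + 1); apply.
  by rewrite addrK -wj; congr w; lia.
have k3 : (2 < k)%N.
  move: k0 wi {kmin}; case: k => [|[|[|k]]] // _ wi.
    by case: (nS i).
  by case: (nSS i).
split=> //.
have [_ wN] := wP i; have [_ wNk] := wP (i + k%:Z).
have wi1 : w (i + k%:Z - 1) = w (i - 1).
  have : e (w i) (w (i + k%:Z - 1)) by rewrite -wi wNk eqxx.
  rewrite wN => /orP[/eqP//|/eqP wik].
  case: (kmin (k - 2)%N _ (i + 1)); first lia.
  by rewrite -wik; congr w; lia.
(* Agreement of the walk with its k-shift on the directed edge ending at time j. *)
pose Q j := w (j + k%:Z) = w j /\ w (j - 1 + k%:Z) = w (j - 1).
have Qi : Q i by split=> //; rewrite -wi1; congr w; lia.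
have QS j : Q j -> Q (j + 1).
  case=> wj wj1; split; last by rewrite addrK.
  have [/negPf ne wNj] := wP j; have [nek wNjk] := wP (j + k%:Z).
  have := wNjk (w (j + k%:Z + 1)); rewrite eqxx orbT wj wNj.
  rewrite -wj1 (_ : j - 1 + k%:Z = j + k%:Z - 1); last lia.
  by rewrite eq_sym (negPf nek) => /eqP <-; congr w; lia.
have QP j : Q j -> Q (j - 1).
  case=> wj wj1; split=> //.
  have [ne wNj] := wP (j - 1); have [nek wNjk] := wP (j - 1 + k%:Z).
  have := wNjk (w (j - 1 + k%:Z - 1)); rewrite eqxx wj1 wNj.
  move: nek; rewrite (_ : j - 1 + k%:Z + 1 = j + k%:Z); last lia.
  rewrite wj subrK => /negPf->; rewrite orbF => /eqP <-; congr w; lia.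
have Qn n : Q (i + n%:Z) /\ Q (i - n%:Z).
  elim: n => [|n [IHp IHn]]; first by split; apply: (eq_ind _ Q Qi); lia.
  by split; [apply: (eq_ind _ Q (QS _ IHp)) | apply: (eq_ind _ Q (QP _ IHn))]; lia.
move=> j; have [n [->|->]] : exists n : nat, j = i + n%:Z \/ j = i - n%:Z.
- by exists `|j - i|%N; lia.
- by have [[]] := Qn n.
- by have [_ []] := Qn n.
Qed.

Lemma straight_walk_mod (w : int -> V) (k : nat) : (0 < k)%N ->
  (forall i, w (i + k%:Z) = w i) ->
  (forall m, (0 < m < k)%N -> forall i, w (i + m%:Z) <> w i) ->
  forall i j, (w i == w j) = (i == j %[mod k])%Z.
Proof.
move=> k0 wk kmin.
have wkn n i : w (i + n%:Z * k%:Z) = w i.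
  elim: n i => [|n IH] i; first by rewrite mul0r addr0.
  by rewrite -(IH i) -[RHS]wk; congr w; rewrite intS; ring.
have wmod i : w (i %% k)%Z = w i.
  have {2}-> := divz_eq i k%:Z; case: (i %/ k%:Z)%Z => n.
    by rewrite addrC wkn.
  by rewrite -(wkn n.+1 (_ + _)); congr w; rewrite NegzE; ring.
move=> i j; apply/eqP/eqP=> [|ij]; last by rewrite -wmod ij wmod.
rewrite -wmod -[RHS]wmod.
have kn0 : k%:Z != 0 by lia.
have := ltz_pmod i (d := k) k0; have := ltz_pmod j (d := k) k0.
have := modz_ge0 i kn0; have := modz_ge0 j kn0.
move: (i %% k)%Z (j %% k)%Z => a b b0 a0 bk ak wab.
have [ab|ab|//] := ltgtP a b.
  by case: (kmin `|b - a|%N _ a); [lia | rewrite wab; congr w; lia].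
by case: (kmin `|b - a|%N _ b); [lia | rewrite -wab; congr w; lia].
Qed.

Lemma two_regular_classification (x : V) :
  graph_isomorphic e line_adj \/
  exists n, (2 < n)%N /\ graph_isomorphic e (@cycle_adj n).
Proof.
have [w wP] := straight_walk_exists x.
have w_surj v := straight_walk_surj v wP.
have [w_inj|w_ninj] := pselect (injective w).
  left; apply: (graph_isomorphic_of_bij w_inj w_surj) => i j.
  by rewrite (wP i).2 !inj_eq // /line_adj; apply/idP/idP; lia.
(* The period is the least time in which the walk returns to some vertex. *)
right; pose returns k := (0 < k)%N && `[< exists i, w (i + k%:Z) = w i >].
have ex_returns : exists k, returns k.
  apply: contrapT => nret; apply: w_ninj => i j wij; apply/eqP/negPn/negP => ij.
  apply: nret; exists `|i - j|%N; apply/andP; split; first lia.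
  by apply/asboolP; have [ji|ij'] := leP i j; [exists i; rewrite wij | exists j; rewrite -wij]; congr w; lia.
case: (ex_minnP ex_returns) => k /andP[k0 /asboolP wik] kleast.
have kmin m : (0 < m < k)%N -> forall i, w (i + m%:Z) <> w i.
  move=> mk i wim; have := kleast m; rewrite /returns.
  case: asboolP => [_ /(_ _)|[]]; [lia | by exists i].
have [k3 wk] := straight_walk_period wP k0 wik kmin.
have wmod := straight_walk_mod k0 wk kmin.
exists k; split=> //.
have wval (i j : 'I_k) : (w i%:Z == w j%:Z) = (i == j).
  by rewrite wmod !modz_nat eqz_nat !modn_small.
have wS (i : 'I_k) : w (ordS i)%:Z = w (i%:Z + 1).
  by apply/eqP; rewrite wmod /= -modz_nat modz_mod -PoszD addn1.
apply: (@graph_isomorphic_of_bij _ _ (fun i : 'I_k => w i%:Z)).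
- by move=> i j /eqP; rewrite wval => /eqP.
- move=> v; have [i wi] := w_surj v.
  have i0 : (0 <= i %% k)%Z by apply: modz_ge0; lia.
  have ik : (`|(i %% k)%Z| < k)%N by have := ltz_pmod i (d := k) k0; lia.
  exists (Ordinal ik); rewrite -wi; apply/eqP; rewrite wmod /=.
  by rewrite gez0_abs // modz_mod.
move=> i j; rewrite (wP i%:Z).2 /cycle_adj -!wval !wS orbC; congr orb.
by rewrite !wmod -(eqz_modDr 1) subrK eq_sym.
Qed.

End TwoRegular.

(** * Cycles of length 3 and 4 *)

Section Girth.
Variables (R : realType) (V : choiceType) (G : weighted_graph R V).

(** The form in which girth at least 5 enters the computations: no 3-cycle
[:: x; y; z] and no 4-cycle [:: x; y; t; z]. *)
Definition no_short_cycle x :=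
  (forall y z, adj G x y -> adj G x z -> ~~ adj G y z) /\
  (forall y z t, adj G x y -> adj G x z -> y != z ->
     adj G t y -> adj G t z -> t = x).

Lemma girth_le_size x c : cycles_through G x c ->
  (girth G x <= (size c)%:R%:E)%E.
Proof. by move=> xc; apply: ereal_inf_lbound; exists c. Qed.

Lemma adj_neq x y : adj G x y -> x != y.
Proof. by apply: contraTneq => ->; rewrite adj_irrefl. Qed.

Lemma no_short_cycle_girth x : (5%:E <= girth G x)%E -> no_short_cycle x.
Proof.
move=> g5.
have long c : cycles_through G x c -> (5 <= size c)%N.
  by move=> /girth_le_size /(le_trans g5); rewrite lee_fin ler_nat.
split=> [y z xy xz|y z t xy xz yz ty tz].
  apply/negP => yz; suff /long : cycles_through G x [:: x; y; z] by [].
  split=> //; last exact: mem_head.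
  rewrite /ucycle /= xy yz adj_sym xz !inE negb_or.
  by rewrite !adj_neq.
apply/eqP/negPn/negP => tx.
suff /long : cycles_through G x [:: x; y; t; z] by [].
split=> //; last exact: mem_head.
rewrite /ucycle /= xy adj_sym ty tz adj_sym xz !inE !negb_or yz.
by rewrite ![x == _]eq_sym tx ![_ == x]eq_sym [y == t]eq_sym !adj_neq.
Qed.

(** A cycle through a vertex y with only two neighbours x, z uses the edge
y - x, so a short cycle through y is a short cycle through x. *)
Lemma no_short_cycle_neighbor x y : no_short_cycle x -> adj G x y ->
  two_neighbors (adj G) y -> no_short_cycle y.
Proof.
move=> [tri sq] xy [a [b [ab yE]]].
have [z [xz yz]] : exists z, x != z /\ forall v, adj G y v = (v == x) || (v == z).
  have: adj G y x by rewrite adj_sym.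
  rewrite yE => /orP[]/eqP xE; subst x; first by exists b.
  by exists a; rewrite eq_sym; split=> // v; rewrite yE orbC.
have yz' : adj G y z by rewrite yz eqxx orbT.
have nxz : ~~ adj G x z by apply: contraL yz' => /(tri _ _ xy).
have sq' t : adj G t x -> adj G t z -> t = y.
  move=> tx tz; apply/eqP/negPn/negP=> ty; move/eqP: xz; apply; apply/esym.
  by apply: (sq t y); rewrite // adj_sym.
split=> [u v|u v t]; rewrite !yz.
  by move=> /orP[]/eqP-> /orP[]/eqP->; rewrite ?adj_irrefl // adj_sym.
by move=> /orP[]/eqP-> /orP[]/eqP->; rewrite ?eqxx // => _ *; apply: sq'.
Qed.

(** The cycle through x is the orbit of the rotation i -> i + 1 of Z/n,
transported to V. It has length at least 3 because neither the rotation nor its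
square has a fixed point when n > 2. *)
Lemma cycle_girth n x : (2 < n)%N -> graph_isomorphic (adj G) (@cycle_adj n) ->
  (girth G x <= n%:R%:E)%E.
Proof.
move=> n2 [h [g hK gK] hE]; pose c := map g (orbit (@ordS n) (h x)).
have S_inj : injective (@ordS n) by exact: (can_inj (@ordSK n)).
have sc : size c = order (@ordS n) (h x) by rewrite size_map size_orbit.
apply: (@le_trans _ _ (size c)%:R%:E); last first.
  by rewrite lee_fin ler_nat sc -[leqRHS]card_ord max_card.
apply: girth_le_size; split.
- rewrite sc; have := order_gt0 (@ordS n) (h x); have := iter_order S_inj (h x).
  have nh := ltn_ord (h x).
  have S1 : ((h x).+1 %% n)%N = if (h x).+1 == n then 0%N else (h x).+1.
    by have [->|?] := eqVneq (h x).+1 n; [rewrite modnn | rewrite modn_small //; lia].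
  case: (order _ _) => [|[|[|m]]] //= /(congr1 val) /=; rewrite S1; first by case: eqP; lia.
  case: eqP => hn; first by rewrite modn_small; lia.
  have [hn'|hn'] := eqVneq (h x).+2 n;
    [by rewrite hn' modnn; lia | by rewrite modn_small; lia].
- rewrite /ucycle map_inj_uniq ?orbit_uniq ?andbT; last exact: can_inj gK.
  rewrite (homo_cycle (e := @cycle_adj n)) //.
    by move=> i j; rewrite -hE !gK.
  apply: (sub_cycle (e := frel (@ordS n))); last exact: cycle_orbit.
  by move=> i j /= /eqP <-; rewrite /cycle_adj eqxx.
- by apply/mapP; exists (h x) => //; rewrite -?fconnect_orbit ?hK.
Qed.

End Girth.

(** * Curvature of unweighted graphs *)

Section Curvature.
Variables (R : realType) (V : choiceType) (G : weighted_graph R V).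
Hypothesis Gphys : unweighted_physical G.

Definition nbrs x : {fset V} := fset_set [set y | adj G x y].

Lemma mem_nbrs x y : (y \in nbrs x) = adj G x y.
Proof.
rewrite /nbrs in_fset_set; last exact: adj_locally_finite.
by apply/idP/idP; rewrite in_setE.
Qed.

Lemma laplacianE f x : laplacian G f x = \sum_(y <- nbrs x) (f y - f x).
Proof.
rewrite /laplacian Gphys.2 invr1 mul1r fsbig_finite; last exact: adj_locally_finite.
apply: eq_big_seq => y; rewrite mem_nbrs => xy.
by rewrite Gphys.1 // mul1r.
Qed.

Lemma GammaE f g x : Gamma G f g x =
  2^-1 * \sum_(y <- nbrs x) (f y - f x) * (g y - g x).
Proof.
rewrite /Gamma !laplacianE; congr (_ * _); rewrite !mulr_sumr -!sumrB.
by apply: eq_bigr => y _ /=; ring.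
Qed.

(** The factor 4 clears the denominators of the two nested Gamma. *)
Lemma Gamma2E f x : 4 * Gamma2 G f x =
  \sum_(y <- nbrs x)
     (\sum_(z <- nbrs y) (f z - f y) ^+ 2 - \sum_(z <- nbrs x) (f z - f x) ^+ 2)
  - 2 * \sum_(y <- nbrs x) (f y - f x) * (laplacian G f y - laplacian G f x).
Proof.
rewrite /Gamma2 laplacianE (GammaE f (laplacian G f)) mulrBr !mulrA.
have -> : (4 : R) * 2^-1 = 2 by field.
congr (_ - _); rewrite mulr_sumr; apply: eq_bigr => y _.
by rewrite !GammaE -mulrBr mulrA divff ?mul1r ?pnatr_eq0.
Qed.

(** In the degree computation every sum over a neighbourhood has a constant term
outside one or two exceptional neighbours. *)
Lemma sum_nbrs_but x y (F : V -> R) (c : R) : adj G y x ->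
  (forall z, adj G y z -> z != x -> F z = c) ->
  \sum_(z <- nbrs y) F z = F x + (degree G y)%:R * c - c.
Proof.
rewrite -mem_nbrs => yx Fc; rewrite (big_fsetD1 x) //= -addrA; congr (_ + _).
rewrite (_ : degree G y = (#|` (nbrs y `\ x)%fset|).+1); last first.
  by rewrite [LHS](cardfsD1 x) yx.
rewrite (eq_big_seq (fun=> c)).
  by rewrite big_const_seq count_predT iter_addr_0 -natr1 -mulr_natl; ring.
by move=> z; rewrite in_fsetD1 mem_nbrs => /andP[zx yz]; apply: Fc.
Qed.

Lemma sum_nbrs_but2 x y1 y2 (F : V -> R) (c : R) : adj G x y1 -> adj G x y2 ->
  y1 != y2 -> (forall z, adj G x z -> z != y1 -> z != y2 -> F z = c) ->
  \sum_(z <- nbrs x) F z = F y1 + F y2 + (degree G x)%:R * c - 2 * c.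
Proof.
move=> xy1 xy2 y12 Fc; pose F' z := if z == y2 then c else F z.
have F'F : \sum_(z <- nbrs x) F z = \sum_(z <- nbrs x) F' z + F y2 - c.
  have y2x : y2 \in nbrs x by rewrite mem_nbrs.
  rewrite [LHS](big_fsetD1 y2) // [X in _ = X + _ - _](big_fsetD1 y2) //=.
  have -> : F' y2 = c by rewrite /F' eqxx.
  have -> : \sum_(z <- (nbrs x `\ y2)%fset) F' z = \sum_(z <- (nbrs x `\ y2)%fset) F z.
    by apply: eq_big_seq => z; rewrite in_fsetD1 /F' => /andP[/negPf-> _].
  by ring.
rewrite F'F (@sum_nbrs_but y1 x F' c) //.
  by rewrite /F' (negPf y12); ring.
by move=> z xz zy1; rewrite /F'; case: eqVneq => // zy2; apply: Fc.
Qed.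

(** Test the curvature on f = s y1 - s y2, where s y is 1 at y, 2 at the
neighbours of y other than x, and 0 elsewhere. Because no 3- or 4-cycle passes
through x, s y vanishes at the other neighbours of x and at theirs; this gives
4 Gamma2(f)(x) = 8 - d(y1) - d(y2) - 2 d(x). *)
Lemma curvature_degree x y1 y2 : no_short_cycle G x ->
  adj G x y1 -> adj G x y2 -> y1 != y2 -> (forall f, 0 <= Gamma2 G f x) ->
  (degree G y1 + degree G y2 + 2 * degree G x <= 8)%N.
Proof.
move=> [tri sq] xy1 xy2 y12 CDx.
pose s y z : R := (z == y)%:R + 2 * (adj G y z && (z != x))%:R.
have sx y : adj G x y -> s y x = 0.
  by move=> xy; rewrite /s (negPf (adj_neq xy)) eqxx andbF mulr0 addr0.
have ss y : s y y = 1 by rewrite /s eqxx adj_irrefl mulr0 addr0.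
have s1 y y' : adj G x y -> adj G x y' -> y' != y -> s y y' = 0.
  by move=> xy xy' ne; rewrite /s (negPf ne) (negPf (tri _ _ xy xy')) mulr0 addr0.
have s2 y z : adj G y z -> z != x -> s y z = 2.
  by move=> yz zx; rewrite /s yz zx eq_sym (negPf (adj_neq yz)) mulr1 add0r.
have s20 y y' z : adj G x y -> adj G x y' -> y' != y -> adj G y' z -> z != x ->
    s y z = 0.
  move=> xy xy' ne y'z zx; rewrite /s.
  have [zy|_] := eqVneq z y; first by move: y'z; rewrite zy (negPf (tri _ _ xy' xy)).
  have [yz|] := boolP (adj G y z); last by rewrite mulr0 addr0.
  by move/eqP: zx; case; apply: (sq y' y); rewrite // adj_sym.
pose f z := s y1 z - s y2 z.
have fx : f x = 0 by rewrite /f !sx // subr0.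
have fy1 : f y1 = 1 by rewrite /f ss s1 // subr0.
have y21 : y2 != y1 by rewrite eq_sym.
have fy2 : f y2 = -1 by rewrite /f ss s1 // sub0r.
have fy y : adj G x y -> y != y1 -> y != y2 -> f y = 0.
  by move=> *; rewrite /f !s1 // subr0.
have fz1 z : adj G y1 z -> z != x -> f z = 2.
  by move=> y1z zx; rewrite /f s2 // (s20 y2 y1) // subr0.
have fz2 z : adj G y2 z -> z != x -> f z = -2.
  by move=> y2z zx; rewrite /f (s20 y1 y2) // s2 // sub0r.
have fz y z : adj G x y -> y != y1 -> y != y2 -> adj G y z -> z != x -> f z = 0.
  by move=> *; rewrite /f !(s20 _ y) // subr0.
have E1 : \sum_(z <- nbrs y1) (f z - f y1) ^+ 2 = (degree G y1)%:R.
  rewrite (@sum_nbrs_but x _ _ 1) 1?adj_sym // fy1 ?fx; first by ring.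
  by move=> z y1z zx; rewrite fz1 //; ring.
have E2 : \sum_(z <- nbrs y2) (f z - f y2) ^+ 2 = (degree G y2)%:R.
  rewrite (@sum_nbrs_but x _ _ 1) 1?adj_sym // fy2 ?fx; first by ring.
  by move=> z y2z zx; rewrite fz2 //; ring.
have E y : adj G x y -> y != y1 -> y != y2 ->
    \sum_(z <- nbrs y) (f z - f y) ^+ 2 = 0.
  move=> xy yy1 yy2; rewrite (@sum_nbrs_but x _ _ 0) 1?adj_sym // (fy y) // ?fx.
    by ring.
  by move=> z yz zx; rewrite (fz y) //; ring.
have Ex : \sum_(z <- nbrs x) (f z - f x) ^+ 2 = 2.
  rewrite (@sum_nbrs_but2 x y1 y2 _ 0) // fx ?fy1 ?fy2; first by ring.
  by move=> z xz zy1 zy2; rewrite fy //; ring.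
have L1 : laplacian G f y1 = (degree G y1)%:R - 2.
  rewrite laplacianE (@sum_nbrs_but x _ _ 1) 1?adj_sym // fy1 ?fx; first by ring.
  by move=> z y1z zx; rewrite fz1 //; ring.
have L2 : laplacian G f y2 = 2 - (degree G y2)%:R.
  rewrite laplacianE (@sum_nbrs_but x _ _ (-1)) 1?adj_sym // fy2 ?fx; first by ring.
  by move=> z y2z zx; rewrite fz2 //; ring.
have Lx : laplacian G f x = 0.
  rewrite laplacianE (@sum_nbrs_but2 x y1 y2 _ 0) // fx ?fy1 ?fy2; first by ring.
  by move=> z xz zy1 zy2; rewrite fy //; ring.
have : 0 <= 4 * Gamma2 G f x by rewrite mulr_ge0.
rewrite Gamma2E Ex (@sum_nbrs_but2 x y1 y2 _ (-2)) //; last first.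
  by move=> z xz zy1 zy2; rewrite E // sub0r.
rewrite (@sum_nbrs_but2 x y1 y2 _ 0) //; last first.
  by move=> z xz zy1 zy2; rewrite fy // fx subr0 mul0r.
rewrite E1 E2 L1 L2 Lx fx fy1 fy2 -(ler_nat R) 2!natrD.
lra.
Qed.

End Curvature.

(** * From degree bounds to 2-regularity *)

Section Degree.
Variables (R : realType) (V : choiceType) (G : weighted_graph R V).

Lemma another_neighbor x y : (1 < degree G x)%N ->
  exists z, z != y /\ adj G x z.
Proof.
move=> dx; suff /fset0Pn[z] : (nbrs G x `\ y != fset0)%fset.
  by rewrite in_fsetD1 mem_nbrs => /andP[]; exists z.
rewrite -cardfs_gt0; have := cardfsD1 y (nbrs G x).
by rewrite -/(degree G x); case: (_ \in _); lia.
Qed.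

Lemma degree2_two_neighbors x : degree G x = 2%N -> two_neighbors (adj G) x.
Proof.
move=> dx; have [y [_ xy]] : exists y, y != x /\ adj G x y.
  by apply: another_neighbor; rewrite dx.
have [z [zy xz]] : exists z, z != y /\ adj G x z.
  by apply: another_neighbor; rewrite dx.
exists y, z; split=> [|v]; first by rewrite eq_sym.
have yzx : ([fset y; z] `<=` nbrs G x)%fset.
  by rewrite fsubUset !fsub1set !mem_nbrs xy.
have /eqP yzE : ([fset y; z] == nbrs G x)%fset.
  by rewrite eqEfcard yzx cardfs2 eq_sym zy; move: dx; rewrite /degree => ->.
by rewrite -mem_nbrs -yzE !inE.
Qed.

End Degree.

Theorem theorem4p3 (R : realType) (V : choiceType) (G : weighted_graph R V)
    (Gphys : unweighted_physical G)
    (GCD : CD0oo G)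
    (Gdeg : (2%:E <= ereal_inf (range (fun x : V => (degree G x)%:R%:E : \bar R)))%E)
    (x0 : V) (Gir5 : (5%:E <= girth G x0)%E) :
  graph_isomorphic (adj G) line_adj \/
  exists n : nat, (5 <= n)%N /\ graph_isomorphic (adj G) (@cycle_adj n).
Proof.
have deg2 x : (1 < degree G x)%N.
  have : (2%:E <= (degree G x)%:R%:E :> \bar R)%E.
    by apply: le_trans Gdeg _; apply: ereal_inf_lbound; exists x.
  by rewrite lee_fin ler_nat.
have deg_nbr x y : no_short_cycle G x -> adj G x y ->
    degree G x = 2%N /\ degree G y = 2%N.
  move=> nx xy; have [z [zy xz]] := another_neighbor y (deg2 x).
  have := curvature_degree Gphys nx xz xy zy (GCD^~ x).
  by have := deg2 x; have := deg2 y; have := deg2 z; lia.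
have no_short x : no_short_cycle G x.
  have [p] := adj_connected G x0 x.
  have := no_short_cycle_girth Gir5.
  elim: p x0 {Gir5} => [|z p IH] y ny /=; first by move=> _ <-.
  move=> /andP[yz]; apply: IH; have [_ dz] := deg_nbr y z ny yz.
  exact: no_short_cycle_neighbor ny yz (degree2_two_neighbors dz).
have two x : two_neighbors (adj G) x.
  apply: degree2_two_neighbors.
  have [y [_ xy]] := another_neighbor x (deg2 x).
  exact: (deg_nbr x y (no_short x) xy).1.
have [|[n [n2 Gn]]] := two_regular_classification (adj_sym G) two
  (adj_irrefl G) (adj_connected G) x0; first by left.
right; exists n; split=> //.
by have := le_trans Gir5 (cycle_girth x0 n2 Gn); rewrite lee_fin ler_nat.
Qed.
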